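(* Let $\mathbf u^h\in V^h$ and $\hat{\mathbf u}^h\in\hat V^h$ satisfy $$\sum_e\int_{\Omega_e}\frac1\rho(\nabla\cdot\mathbf u^h)\,q^h_v=0\quad\forall q^h_v\in Q^h_v,\qquad \sum_e\sum_i\int_{\Gamma_{e_i}}\frac1\rho(\mathbf u^h-\hat{\mathbf u}^h)\cdot\mathbf n\,\hat q^h_v=0\quad\forall\hat q^h_v\in\hat Q^h_v .$$ Then $$\nabla\cdot\mathbf u^h=0\quad\forall\mathbf x\in\Omega_e\text{ and }\forall\Omega_e\in\mathcal T,$$ $$[\![\mathbf u^h]\!]=0\quad\forall\mathbf x\in F\text{ and }\forall F\in\mathcal F_{\rm int},$$ $$\mathbf u^h\cdot\mathbf n=\hat{\mathbf u}^h\cdot\mathbf n\quad\forall\mathbf x\in F\text{ and }\forall F\in\mathcal F_{\rm bdy}.$$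
   Context: $\Omega\subset\mathbb R^d$, $d\in\{2,3\}$, is a bounded domain and $\rho>0$ is a constant. $\mathcal T=\{\Omega_e\}$ is a finite triangulation of $\Omega$ into simplices, $\bar\Omega=\overline{\cup_e\Omega_e}$; $\Gamma_{e_i}$ is the $i$-th facet of $\Omega_e$, and $\mathbf n$ on $\Gamma_{e_i}$ is the outward unit normal to $\Omega_e$. $\mathcal F$ is the set of all facets and $\tilde\Gamma=\overline{\cup_{F\in\mathcal F}F}$ the mesh skeleton. $\mathcal F_{\rm bdy}$ is the set of facets lying on $\partial\Omega$ and $\mathcal F_{\rm int}$ the set of the other facets; each $F\in\mathcal F_{\rm int}$ is shared by exactly two elements $\Omega_{e^+},\Omega_{e^-}$, with outward normals $\mathbf n^+,\mathbf n^-$ on $F$ ($\mathbf n^++\mathbf n^-=\mathbf 0$). The normal jump across $F$ is $[\![\mathbf y]\!]=\mathbf y^+\cdot\mathbf n^++\mathbf y^-\cdot\mathbf n^-$, $\mathbf y^\pm=\mathbf y|_{\Omega_{e^\pm}}$. $P_k(D)$ denotes polynomials of degree at most $k$ on $D$. For $k\ge1$: $V^h=\{\mathbf v\in[L^2(\Omega)]^d:\mathbf v|_{\Omega_e}\in[P_k(\Omega_e)]^d\ \forall\Omega_e\in\mathcal T\}$; $\hat V^h=\{\hat{\mathbf v}\in[L^2(\tilde\Gamma)]^d:\hat{\mathbf v}|_F\in[P_k(F)]^d\ \forall F\in\mathcal F\}$; $Q^h_v=\{q\in L^2(\Omega):q|_{\Omega_e}\in P_{k-1}(\Omega_e)\ \forall\Omega_e\in\mathcal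 T\}$; $\hat Q^h_v=\{\hat q\in L^2(\tilde\Gamma):\hat q|_F\in P_k(F)\ \forall F\in\mathcal F\}$. In integrals over $\Gamma_{e_i}$, $\mathbf u^h$ is evaluated from inside $\Omega_e$, while functions in $\hat V^h,\hat Q^h_v$ are single-valued on each facet.
   Formalization: The formal statement adds that each facet lying on the boundary of Ω belongs to exactly one element; on a slit domain meshed on both sides, u = 0 with û normal on a slit facet satisfies both equations but violates the third conclusion. *)

(* Defs.v *)
From HB Require Import structures.
From mathcomp Require Import all_boot all_order all_algebra.
From mathcomp Require Import -(notations) mpoly.
From mathcomp Require Import all_classical all_reals all_analysis.
Set Implicit Arguments.
Unset Strict Implicit.
Unset Printing Implicit Defensive.
Import Order.TTheory GRing.Theory Num.Theory numFieldNormedType.Exports.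
Local Open Scope classical_set_scope.
Local Open Scope ring_scope.

(* The product sigma-algebra on row vectors, generated by the coordinates; for
   T = R it is the Borel sigma-algebra of R^n. *)
Section rV_measurable.
Context {d : measure_display} {T : measurableType d} {n : nat}.

Let coord (i : 'I_n) (x : 'rV[T]_n) : T := x ord0 i.

Let rV_set0 : g_sigma_preimage coord set0.
Proof. exact: sigma_algebra0. Qed.

Let rV_setC A : g_sigma_preimage coord A -> g_sigma_preimage coord (~` A).
Proof. exact: sigma_algebraC. Qed.

Let rV_bigcup (F : _^nat) : (forall i, g_sigma_preimage coord (F i)) ->
  g_sigma_preimage coord (\bigcup_i (F i)).
Proof. exact: sigma_algebra_bigcup. Qed.

HB.instance Definition _ := @isMeasurable.Build (measure_tuple_display d)
  'rV[T]_n (g_sigma_preimage coord) rV_set0 rV_setC rV_bigcup.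

Lemma measurable_coord (i : 'I_n) :
  measurable_fun setT (fun x : 'rV[T]_n => x ord0 i).
Proof.
move=> _ Y mY; rewrite setTI; apply: sub_sigma_algebra => /=.
rewrite -bigcup_seq/=; exists i => /=; first by rewrite mem_index_enum.
by exists Y => //; rewrite setTI.
Qed.

Lemma measurable_fun_rV d1 (S : measurableType d1) (f : S -> 'rV[T]_n) :
  (forall i, measurable_fun setT (fun x => f x ord0 i)) ->
  measurable_fun setT f.
Proof.
move=> mf _ A mA; rewrite setTI.
have : preimage_set_system setT f (g_sigma_preimage coord) (f @^-1` A).
  by exists A => //; rewrite setTI.
rewrite /g_sigma_preimage -g_sigma_preimageE; apply: smallest_sub.
  exact: sigma_algebra_measurable.
move=> B [C]; rewrite -bigcup_seq/= => -[i _ [D mD <-]] <-.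
by have := mf i measurableT D mD; rewrite !setTI.
Qed.

End rV_measurable.


Lemma sigma_finite_measure_of d (T : measurableType d) (R : realType)
    (mu : {measure set T -> \bar R}) : sigma_finite setT mu ->
  {m : {sigma_finite_measure set T -> \bar R} | mu = m :> (set T -> \bar R)}.
Proof.
case: mu => f c sf; pose m : {measure set T -> \bar R} := Measure.Pack c.
pose S := Measure_isSigmaFinite.Build _ _ _ m sf.
pose m' : {sigma_finite_measure set T -> \bar R} :=
  HB.pack (f : set T -> \bar R) c S.
by exists m'.
Qed.

Section lebesgue_rV.
Context {R : realType}.

Definition cons_rV n (p : R * 'rV[R]_n) : 'rV[R]_n.+1 :=
  \row_(i < n.+1) if unlift ord0 i is Some j then p.2 ord0 j else p.1.

(* Lebesgue measure on R^n, as an iterated product of [lebesgue_measure]. *)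
Fixpoint lebesgue_rV (n : nat) : set 'rV[R]_n -> \bar R :=
  if n is m.+1 then
    pushforward (lebesgue_measure \x @lebesgue_rV m)%E (@cons_rV m)
  else \d_(0 : 'rV[R]_0).

Lemma measurable_cons_rV n : measurable_fun setT (@cons_rV n).
Proof.
apply: measurable_fun_rV => i; rewrite /cons_rV.
case: (unliftP ord0 i) => [j|] ->.
  rewrite (_ : (fun _ => _) = (fun x : 'rV[R]_n => x ord0 j) \o snd).
    exact: measurableT_comp (measurable_coord j) measurable_snd.
  by apply/funext => p; rewrite mxE liftK.
rewrite (_ : (fun _ => _) = fst); first exact: measurable_fst.
by apply/funext => p; rewrite mxE unlift_none.
Qed.

Lemma lebesgue_rV_sigma_finite_measure n :
  {m : {sigma_finite_measure set 'rV[R]_n -> \bar R} | @lebesgue_rV n = m}.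
Proof.
elim: n => [|n [m mE]].
  pose d0 : {finite_measure set 'rV[R]_0 -> \bar R} := \d_(0 : 'rV[R]_0).
  by exists d0.
have mcons : measurable_fun setT (@cons_rV n : measurableTypeR R * _ -> _).
  exact: measurable_cons_rV.
pose mu0 : {measure set _ -> \bar R} :=
  pushforward (lebesgue_measure \x m)%E (@cons_rV n).
pose mu := mu0 mcons.
have sf : sigma_finite setT mu.
  have /sigma_finiteP[F [FT ndF Ffin]] :=
    sigma_finiteT (@lebesgue_measure R).
  have /sigma_finiteP[G [GT ndG Gfin]] := sigma_finiteT m.
  pose g (x : 'rV[R]_n.+1) : measurableTypeR R * 'rV[R]_n :=
    (x ord0 ord0, \row_j x ord0 (lift ord0 j)).
  have gK : cancel (@cons_rV n) g.
    case=> t y; rewrite /g !mxE unlift_none; congr pair.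
    by apply/rowP => j; rewrite !mxE liftK.
  have mg : measurable_fun setT g.
    apply/measurable_fun_pairP; split; first exact: measurable_coord.
    apply: measurable_fun_rV => i /=.
    under eq_fun do rewrite mxE.
    exact: measurable_coord.
  exists (fun i => g @^-1` (F i `*` G i)).
    apply/esym; rewrite -subTset => x _.
    have [a _ Fa] : (\bigcup_i F i) (g x).1 by rewrite -FT.
    have [b _ Gb] : (\bigcup_i G i) (g x).2 by rewrite -GT.
    exists (maxn a b) => //; split.
    - by move: Fa; exact/subsetPset/ndF/leq_maxl.
    - by move: Gb; exact/subsetPset/ndG/leq_maxr.
  move=> i; have [mFi Fi_fin] := Ffin i; have [mGi Gi_fin] := Gfin i; split.
    by rewrite -[X in measurable X]setTI; apply: mg => //; exact: measurableX.
  rewrite (_ : mu _ = (lebesgue_measure \x m)%E (F i `*` G i)).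
    by rewrite product_measure1E// lte_mul_pinfty// ge0_fin_numE.
  rewrite /mu /mu0 /= /pushforward; congr (_ _).
  by apply/funext => p; rewrite /preimage /mkset gK.
have muE : @lebesgue_rV n.+1 = mu by rewrite /= mE.
by have [m' m'E] := sigma_finite_measure_of sf; exists m'; rewrite muE.
Qed.


Let lebesgue_rV0 n : @lebesgue_rV n set0 = 0%E.
Proof.
by have [m ->] := lebesgue_rV_sigma_finite_measure n; exact: measure0.
Qed.

Let lebesgue_rV_ge0 n A : (0 <= @lebesgue_rV n A)%E.
Proof.
by have [m ->] := lebesgue_rV_sigma_finite_measure n; exact: measure_ge0.
Qed.

Let lebesgue_rV_semi_sigma_additive n : semi_sigma_additive (@lebesgue_rV n).
Proof.
have [m ->] := lebesgue_rV_sigma_finite_measure n.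
exact: measure_semi_sigma_additive.
Qed.

HB.instance Definition _ n := isMeasure.Build _ _ _ (@lebesgue_rV n)
  (lebesgue_rV0 n) (@lebesgue_rV_ge0 n) (@lebesgue_rV_semi_sigma_additive n).

Let lebesgue_rV_sigma_finite n : sigma_finite setT (@lebesgue_rV n).
Proof.
by have [m ->] := lebesgue_rV_sigma_finite_measure n; exact: sigma_finiteT.
Qed.

HB.instance Definition _ n := Measure_isSigmaFinite.Build _ _ _ (@lebesgue_rV n)
  (lebesgue_rV_sigma_finite n).

End lebesgue_rV.
Arguments lebesgue_rV {R n}.

Section vector_calculus.
Context {R : realType} {d : nat}.
Implicit Types (x y : 'rV[R]_d) (A D : set 'rV[R]_d).

Definition dot x y : R := \sum_i x ord0 i * y ord0 i.

Definition boundary A : set 'rV[R]_d := closure A `\` A°.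

Definition divergence (u : 'rV[R]_d -> 'rV[R]_d) x : R :=
  \sum_(i < d) 'D_(delta_mx ord0 i) (fun y => u y ord0 i : R) x.

(* The restrictions to D of the polynomials of total degree at most k;
   [msize p] is one more than the degree of p. *)
Definition P_ (k : nat) D (f : 'rV[R]_d -> R) : Prop :=
  exists2 p : mpoly d R, (msize p <= k.+1)%N &
    forall x, D x -> f x = meval (fun i => x ord0 i) p.

Definition square_integrable D (f : 'rV[R]_d -> R) : Prop :=
  measurable_fun D f /\ (\int[lebesgue_rV]_(x in D) ((f x) ^+ 2)%:E < +oo)%E.

End vector_calculus.

Definition facets_of (d : nat) (V : finType) (e : {set V}) : {set {set V}} :=
  [set F : {set V} | (F \subset e) && (#|F| == d)].

Section simplices.
Context {R : realType} {d : nat} {V : finType} (pos : V -> 'rV[R]_d).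
Implicit Types S F e : {set V}.

Definition affinely_independent S : Prop :=
  forall w : V -> R, \sum_(v in S) w v = 0 -> \sum_(v in S) w v *: pos v = 0 ->
    forall v, v \in S -> w v = 0.

Definition closed_simplex S : set 'rV[R]_d :=
  [set x | exists w : V -> R, [/\ forall v, v \in S -> 0 <= w v,
    \sum_(v in S) w v = 1 & x = \sum_(v in S) w v *: pos v]].

(* The relative interior of [closed_simplex S]: elements, which have d + 1
   vertices, are open subsets of R^d and facets are relatively open. *)
Definition open_simplex S : set 'rV[R]_d :=
  [set x | exists w : V -> R, [/\ forall v, v \in S -> 0 < w v,
    \sum_(v in S) w v = 1 & x = \sum_(v in S) w v *: pos v]].

Definition is_outward_unit_normal e F (n : 'rV[R]_d) : Prop :=
  [/\ dot n n = 1,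
      forall v w, v \in F -> w \in F -> dot n (pos v - pos w) = 0 &
      forall v w, v \in e -> v \notin F -> w \in F -> dot n (pos v - pos w) < 0].

Definition reference_simplex m : set 'rV[R]_m :=
  [set s | (forall i, 0 < s ord0 i) /\ \sum_i s ord0 i < 1].

Definition facet_vertices F : seq 'rV[R]_d := [seq pos v | v <- enum F].

Definition facet_edges F : 'M[R]_(d.-1, d) :=
  \matrix_(i < d.-1) ((facet_vertices F)`_i.+1 - (facet_vertices F)`_0).

Definition facet_map F (s : 'rV[R]_d.-1) : 'rV[R]_d :=
  (facet_vertices F)`_0 + s *m facet_edges F.

(* The (d-1)-dimensional surface integral over F, through the affine
   parametrization of F by the reference simplex; the factor is the square root
   of the Gram determinant of the edges. [facet_map] depends on F alone, not on
   an element containing F. *)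
Definition facet_integral F (f : 'rV[R]_d -> R) : R :=
  Num.sqrt (\det (facet_edges F *m (facet_edges F)^T)) *
  \int[lebesgue_rV]_(s in @reference_simplex d.-1) f (facet_map F s).

End simplices.

(* Elements and facets are identified with their sets of vertices. *)
Record triangulation (R : realType) (d : nat) (Omega : set 'rV[R]_d) := {
  vertex : finType;
  pos : vertex -> 'rV[R]_d;
  elements : {set {set vertex}};
  element_card : forall e, e \in elements -> #|e| = d.+1;
  element_nondegenerate :
    forall e, e \in elements -> affinely_independent pos e;
  element_sub : forall e, e \in elements -> open_simplex pos e `<=` Omega;
  elements_cover :
    closure Omega = closure (\bigcup_(e in [set` elements]) open_simplex pos e);
  elements_meet : forall e e', e \in elements -> e' \in elements ->
    closed_simplex pos e `&` closed_simplex pos e' =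
    closed_simplex pos (e :&: e');
  interior_facet_shared : forall e F, e \in elements -> F \in facets_of d e ->
    ~ (open_simplex pos F `<=` boundary Omega) ->
    #|[set e' in elements | F \subset e']| = 2%N;
  (* Excludes slits, i.e. facets of two elements that lie on the boundary, where
     neither the outward normal nor the trace would be single-valued. *)
  boundary_facet_unshared : forall e F, e \in elements -> F \in facets_of d e ->
    open_simplex pos F `<=` boundary Omega ->
    #|[set e' in elements | F \subset e']| = 1%N }.

Section discrete_spaces.
Context {R : realType} {d : nat} {Omega : set 'rV[R]_d}.
Context (T : triangulation Omega).
Implicit Types (e F : {set vertex T}) (k : nat).

Definition facets : {set {set vertex T}} :=
  \bigcup_(e in elements T) facets_of d e.

Definition element e : set 'rV[R]_d := open_simplex (@pos _ _ _ T) e.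

Definition facet F : set 'rV[R]_d := open_simplex (@pos _ _ _ T) F.

Definition boundary_facet F : Prop :=
  F \in facets /\ facet F `<=` boundary Omega.

Definition interior_facet F : Prop :=
  F \in facets /\ ~ (facet F `<=` boundary Omega).

(* The surface measure of the skeleton restricts to each facet as a positive
   multiple of the image of the Lebesgue measure by [facet_map]. *)
Definition skeleton_square_integrable (f : 'rV[R]_d -> R) : Prop :=
  forall F, F \in facets ->
    square_integrable (@reference_simplex R d.-1)
      (f \o facet_map (@pos _ _ _ T) F).

(* Members of the discrete spaces are pointwise representatives, equal to a
   polynomial everywhere on each open element, resp. each relatively open
   facet; their values elsewhere are irrelevant. *)
Definition V_h k : set ('rV[R]_d -> 'rV[R]_d) :=
  [set v | forall i : 'I_d, square_integrable Omega (fun x => v x ord0 i) /\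
    forall e, e \in elements T -> P_ k (element e) (fun x => v x ord0 i)].

Definition Vhat_h k : set ('rV[R]_d -> 'rV[R]_d) :=
  [set v | forall i : 'I_d, skeleton_square_integrable (fun x => v x ord0 i) /\
    forall F, F \in facets -> P_ k (facet F) (fun x => v x ord0 i)].

Definition Q_h k : set ('rV[R]_d -> R) :=
  [set q | square_integrable Omega q /\
    forall e, e \in elements T -> P_ k.-1 (element e) q].

Definition Qhat_h k : set ('rV[R]_d -> R) :=
  [set q | skeleton_square_integrable q /\
    forall F, F \in facets -> P_ k (facet F) q].

(* The value of u at a point of the closure of the element e, from inside e. *)
Definition trace e (u : 'rV[R]_d -> 'rV[R]_d) (x : 'rV[R]_d) : 'rV[R]_d :=
  lim (u y @[y --> within (element e) (nbhs x)]).

Definition normal_jump (n : {set vertex T} -> {set vertex T} -> 'rV[R]_d)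
    (ep em F : {set vertex T}) (u : 'rV[R]_d -> 'rV[R]_d) (x : 'rV[R]_d) : R :=
  dot (trace ep u x) (n ep F) + dot (trace em u x) (n em F).

End discrete_spaces.

(* Main.v *)
(* If div u = g on an element e, then g extended by zero is an admissible test
   function, so the first equation gives int_e g^2 = 0 and the polynomial g
   vanishes on e.  For a facet F the sum g of (u - uhat).n over the elements
   containing F is a polynomial of degree at most k on F; testing the second
   equation with g extended by zero to the other facets gives int_F g^2 = 0, so
   g = 0 on F.  On a boundary facet this sum has one term; on an interior facet
   the two outward normals are opposite, so uhat cancels and g is the jump. *)
Require Import Defs.
From mathcomp Require Import all_boot all_order all_algebra.
From mathcomp Require Import -(notations) mpoly.
From mathcomp Require Import all_classical all_reals all_analysis measurable_realfun.
Set Implicit Arguments.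
Unset Strict Implicit.
Unset Printing Implicit Defensive.
Import Order.TTheory GRing.Theory Num.Theory numFieldNormedType.Exports.
Local Open Scope classical_set_scope.
Local Open Scope ring_scope.

(** The zero extensions are well defined and piecewise polynomial because open faces of the mesh
    with different vertex sets are disjoint; this comes from [elements_meet] and the uniqueness of
    barycentric weights. Differentiation lowers the degree by one, so the divergence fits the degree
    k - 1 of [Q_h]; the trace on a facet is the element's own polynomial read on the closure, so its
    degree stays at most k. That a zero integral of g^2 forces g = 0 rests on openness, which a
    facet has only after pulling back to the reference simplex of dimension d - 1; the Gram factor
    must then be nonzero. The opposite normals are not assumed: both are proportional to one
    barycentric coordinate, hence equal up to sign, and equal normals would make the two elements
    overlap. *)

(** * Polynomial functions and the spaces [P_] *)

Section polynomial_functions.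
Context {R : realType} {n : nat}.
Implicit Types (p q : mpoly n R) (x : 'rV[R]_n) (D : set 'rV[R]_n).

Definition ev p x : R := meval (fun i => x ord0 i) p.

(** Constants and variables generate the polynomial ring, so any property stable under sums and
    products need only be checked on these. *)
Lemma mpoly_ring_ind (Q : mpoly n R -> Prop) :
  (forall c, Q (mpolyC n c)) -> (forall i, Q (mpolyX R (mnm1 i))) ->
  (forall p q, Q p -> Q q -> Q (p + q)) ->
  (forall p q, Q p -> Q q -> Q (p * q)) -> forall p, Q p.
Proof.
move=> QC QX QD QM p; rewrite (mpolyE p).
have Q0 : Q 0 by rewrite -mpolyC0.
have Q1 : Q 1 by rewrite -mpolyC1.
apply: (big_ind Q) => [//|x y|m _]; first exact: QD.
rewrite -mul_mpolyC; apply: (QM) => //.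
rewrite mpolyXE_id; apply: (big_ind Q) => [//|x y|i _]; first exact: QM.
by elim: (fun_of_multinom m i) => [|j IH]; rewrite ?expr0// exprS; exact: QM.
Qed.

Lemma evC c : ev (mpolyC n c) = cst c.
Proof. by apply/funext => x; rewrite /ev mevalC. Qed.

Lemma evX i : ev (mpolyX R (mnm1 i)) = fun x => x ord0 i.
Proof. by apply/funext => x; rewrite /ev mevalXU. Qed.

Lemma evD p q : ev (p + q) = ev p + ev q.
Proof. by apply/funext => x; rewrite /ev mevalD. Qed.

Lemma evM p q : ev (p * q) = ev p * ev q.
Proof. by apply/funext => x; rewrite /ev mevalM. Qed.

Lemma ev_continuous p : continuous (ev p).
Proof.
elim/mpoly_ring_ind: p => [c|i|p q IHp IHq|p q IHp IHq] x.
- rewrite evC; exact: cst_continuous.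
- rewrite evX; exact: coord_continuous.
- rewrite evD; exact: continuousD (IHp x) (IHq x).
- rewrite evM; exact: continuousM (IHp x) (IHq x).
Qed.

Lemma ev_measurable p : measurable_fun setT (ev p).
Proof.
elim/mpoly_ring_ind: p => [c|i|p q IHp IHq|p q IHp IHq].
- by rewrite evC.
- rewrite evX; exact: measurable_coord.
- rewrite evD; exact: measurable_funD IHp IHq.
- rewrite evM; exact: measurable_funM IHp IHq.
Qed.

Lemma ev_bounded p (M : R) : exists C, forall x,
  (forall i, `|x ord0 i| <= M) -> `|ev p x| <= C.
Proof.
elim/mpoly_ring_ind: p => [c|i|p q [C hC] [C' hC']|p q [C hC] [C' hC']].
- by exists `|c| => x _; rewrite /ev mevalC.
- by exists M => x hx; rewrite /ev mevalXU.
- exists (C + C') => x hx; rewrite /ev mevalD.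
  by rewrite (le_trans (ler_normD _ _))// lerD ?hC ?hC'.
- exists (C * C') => x hx; rewrite /ev mevalM normrM.
  by rewrite ler_pM ?hC ?hC'.
Qed.

Lemma ev_is_derive p (i : 'I_n) x :
  is_derive x (delta_mx ord0 i) (ev p) (ev (mderiv i p) x).
Proof.
elim/mpoly_ring_ind: p => [c|j|p q IHp IHq|p q IHp IHq].
- rewrite mderivC {2}/ev meval0 evC; exact: is_derive_cst.
- rewrite evX.
  have -> : ev (mderiv i (mpolyX R (mnm1 j))) x = (i == j)%:R.
    rewrite /ev mderivX mevalZ mnm1E eq_sym.
    case: eqVneq => [->|_]; last by rewrite mul0r.
    rewrite mul1r (_ : mnm_sub _ _ = mnm0) ?mpolyX0 ?meval1//.
    by apply/mnmP => l; rewrite mnmBE mnm0E subnn.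
  (* The difference quotient of a coordinate function is constant for h nonzero. *)
  have dq : (fun h : R => h^-1 *: ((h *: delta_mx ord0 i + x) ord0 j
       - x ord0 j)) @ 0^' --> ((i == j)%:R : R).
    apply: cvg_near_cst.
    near=> h; rewrite !mxE eqxx/= addrK /= eq_sym.
    by rewrite scalerA mulVf ?scale1r// ; near: h; exact: nbhs_dnbhs_neq.
  split; first by rewrite /derivable; apply/cvg_ex; exists (i == j)%:R.
  by rewrite /derive; apply/cvg_lim.
- rewrite mderivD !evD; exact: is_deriveD.
- rewrite mderivM evD !evM.
  have := is_deriveM IHp IHq; congr (is_derive _ _ _ _).
  by rewrite /GRing.scale /= addrC mulrC.
Unshelve. all: by end_near. Qed.

(** A monomial m of the derivative comes from the monomial m + e_i of [p], whose degree is larger by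
    one. *)
Lemma msize_mderiv i p k : (msize p <= k.+1)%N -> (msize (mderiv i p) <= k)%N.
Proof.
move=> pk; rewrite msizeE; apply/bigmax_leqP_seq => m mp _.
have : mnm_add m (mnm1 i) \in msupp p.
  move: mp; rewrite !mcoeff_msupp mcoeff_mderiv.
  by apply: contraNN => /eqP->; rewrite mul0rn.
by move=> /msize_mdeg_lt /leq_trans /(_ pk); rewrite mdegD mdeg1 addn1.
Qed.

Lemma P_eq k D f g : (forall x, D x -> f x = g x) -> P_ k D g -> P_ k D f.
Proof. by move=> fg [p pk gp]; exists p => // x Dx; rewrite fg// gp. Qed.

Lemma P_0 k D : P_ k D (fun=> 0).
Proof. by exists 0 => [|x _]; rewrite ?meval0 ?msize0. Qed.

Lemma P_add k D f g : P_ k D f -> P_ k D g -> P_ k D (fun x => f x + g x).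
Proof.
move=> [p pk fp] [q qk gq]; exists (p + q) => [|x Dx].
  by rewrite (leq_trans (msizeD_le _ _))// geq_max pk.
by rewrite mevalD fp// gq.
Qed.

Lemma P_scale k D f (c : R) : P_ k D f -> P_ k D (fun x => f x * c).
Proof.
move=> [p pk fp]; exists (c *: p) => [|x Dx].
  by rewrite (leq_trans (msizeZ_le _ _)).
by rewrite mevalZ fp// mulrC.
Qed.

Lemma P_sum k D (I : Type) (r : seq I) (Q : pred I) (f : I -> 'rV[R]_n -> R) :
  (forall i, Q i -> P_ k D (f i)) -> P_ k D (fun x => \sum_(i <- r | Q i) f i x).
Proof.
move=> Pf; elim: r => [|i r IH].
  by apply: P_eq (P_0 _ _) => x _; rewrite big_nil.
have [Qi|Qi] := boolP (Q i); last first.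
  by apply: P_eq IH => x _; rewrite big_cons (negbTE Qi).
apply: P_eq (P_add (Pf _ Qi) IH) => x _.
by rewrite big_cons Qi.
Qed.

End polynomial_functions.

(** * Integrals of polynomials over bounded subsets of R^n *)

Section integration.
Context {R : realType}.

(** Sup-norm balls in coordinate form: products of intervals, on which the recursion of
    [lebesgue_rV] can be followed. *)
Definition box {n} (c : 'rV[R]_n) (r : R) : set 'rV[R]_n :=
  [set y | forall i, ball (c ord0 i) r (y ord0 i)].

Lemma measurable_box n (c : 'rV[R]_n) (r : R) : measurable (box c r).
Proof.
rewrite (_ : box c r = \bigcap_(i in setT)
    ((fun y : 'rV[R]_n => y ord0 i) @^-1` ball (c ord0 i) r)); last first.
  by apply/seteqP; split => y /= h i; [move=> _; exact: h|exact: h].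
apply: fin_bigcap_measurable => // i _.
rewrite -[X in measurable X]setTI; apply: measurable_coord => //.
exact: measurable_ball.
Qed.

Lemma lebesgue_box n (c : 'rV[R]_n) (r : R) : 0 < r ->
  lebesgue_rV (box c r) = ((r *+ 2) ^+ n)%:E.
Proof.
move=> r0; elim: n c => [|n IH] c.
  by rewrite /= diracE mem_set// => -[].
rewrite /= /pushforward (_ : _ @^-1` _ =
    ball (c ord0 ord0) r `*` box (\row_j c ord0 (lift ord0 j)) r); last first.
  apply/seteqP; split => -[t y] /=; rewrite /box /cons_rV /=.
    move=> h; split; first by have := h ord0; rewrite mxE unlift_none.
    by move=> i /=; have := h (lift ord0 i); rewrite !mxE liftK.
  move=> [h1 h2] i; rewrite mxE; case: unliftP => [j|] -> //=.
  by have := h2 j; rewrite mxE.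
rewrite product_measure1E//; [|exact: measurable_ball|exact: measurable_box].
rewrite [X in (X * _)%E](lebesgue_measure_ball (c ord0 ord0) (ltW r0)).
by rewrite [X in (_ * X)%E]IH -EFinM exprS.
Qed.

Lemma open_box n (D : set 'rV[R]_n) x : open D -> D x ->
  exists2 r, 0 < r & box x r `<=` D.
Proof.
move=> oD Dx; have /nbhs_ballP[r /= r0 rD] : nbhs x D by exact: open_nbhs_nbhs.
exists r => // y xy; apply: rD; split => // i j.
by rewrite ord1; exact: xy.
Qed.

Definition bounded_rV n (D : set 'rV[R]_n) :=
  exists M, forall x, D x -> forall i, `|x ord0 i| <= M.

Lemma finite_bounded_rV n (D : set 'rV[R]_n) : measurable D -> bounded_rV D ->
  (lebesgue_rV D < +oo)%E.
Proof.
move=> mD [M DM].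
(* [M] may be negative and the box is open, hence the absolute value and the extra 1. *)
have r0 : 0 < `|M| + 1 by rewrite ltr_wpDl.
apply: (@le_lt_trans _ _ (lebesgue_rV (box (0 : 'rV[R]_n) (`|M| + 1)))).
  apply: le_measure; rewrite ?inE//; first exact: measurable_box.
  move=> x /DM xM i; rewrite /ball/= mxE sub0r normrN.
  by rewrite (le_lt_trans (xM i))// (le_lt_trans (ler_norm _))// ltrDl.
by rewrite lebesgue_box// ltry.
Qed.

Lemma ev_integrable n (D : set 'rV[R]_n) p : measurable D -> bounded_rV D ->
  lebesgue_rV.-integrable D (EFin \o ev p).
Proof.
move=> mD bD; apply: measurable_bounded_integrable => //.
- exact: finite_bounded_rV.
- exact: measurable_funS (ev_measurable p).
- have [M DM] := bD; have [C pC] := ev_bounded p M.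
  exists C; split; first exact: num_real.
  by move=> C' CC' x Dx /=; rewrite (le_trans (pC _ (DM _ Dx)))// ltW.
Qed.

(** The square is zero almost everywhere on D. If [p] were nonzero at a point of D, it would be
    nonzero on a whole box around it by continuity, and a null set would contain a box of positive
    volume. *)
Lemma ev_sqr_integral_eq0 n (D : set 'rV[R]_n) p : measurable D -> open D ->
  bounded_rV D -> \int[lebesgue_rV]_(x in D) (ev p x ^+ 2) = 0 ->
  forall x, D x -> ev p x = 0.
Proof.
move=> mD oD bD.
have e2 x : ev (p ^+ 2) x = ev p x ^+ 2 by rewrite expr2 evM.
rewrite -(funext e2) => I0 x0 Dx0.
have /integrableP[mp2 _] := ev_integrable (p ^+ 2) mD bD.
(* The real-valued integral is the [fine] part of the extended one and is also 0 when that is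
   infinite; integrability excludes this case. *)
have I0' : (\int[lebesgue_rV]_(x in D) `|(EFin \o ev (p ^+ 2)%R) x| = 0)%E.
  transitivity (\int[lebesgue_rV]_(x in D) (ev (p ^+ 2)%R x)%:E)%E.
    by apply: eq_integral => x _; rewrite /= e2 ger0_norm// sqr_ge0.
  rewrite -[LHS]fineK; first by rewrite -[fine _]/(Rintegral _ _ _) I0.
  exact: integrable_fin_num (ev_integrable _ mD bD).
have /ae_eq_integral_abs := I0' => /(_ mD mp2).
move=> [N [mN N0 sN]]; apply/eqP/negPn/negP => px0.
pose E := D `&` [set x | ev p x != 0].
have oE : open E.
  apply: openI => //.
  rewrite (_ : mkset _ = ev p @^-1` [set y | y != 0])//.
  apply: open_comp; last exact: open_neq.
  by move=> x _; exact: ev_continuous.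
have [r r0 rE] := @open_box _ E x0 oE (conj Dx0 px0).
have : (lebesgue_rV (box x0 r) <= lebesgue_rV N)%E.
  apply: le_measure; rewrite ?inE//; first exact: measurable_box.
  move=> x /rE [Dx px]; apply: sN => /= /(_ Dx) /eqP.
  by rewrite /= e2 eqe sqrf_eq0; apply/negP.
by rewrite N0 lebesgue_box// lee_fin leNgt exprn_gt0// mulrn_wgt0.
Qed.
End integration.

(** * Sets cut out by finitely many strict polynomial inequalities *)

Section positivity_sets.
Context {R : realType} {n : nat} {I : finType}.
Variables (Q : pred I) (f : I -> 'rV[R]_n -> R).
Hypothesis fp : forall i, exists p, f i = ev p.

Let gt0E : [set x | forall i, Q i -> 0 < f i x] =
  \bigcap_(i in [set i | Q i]) [set x | 0 < f i x].
Proof. by apply/seteqP; split => x h i; exact: h. Qed.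

Lemma open_gt0 : open [set x | forall i, Q i -> 0 < f i x].
Proof.
rewrite openE => x Ux; apply: (@filter_forall _ I
  (fun i => [set y | Q i -> 0 < f i y]) _ (nbhs_filter x)) => i.
have [Qi|_] := boolP (Q i); last exact: nearW.
have [p fE] := fp i; have : nbhs (f i x) [set y | 0 < y].
  by apply: open_nbhs_nbhs; split; [exact: open_gt|exact: Ux].
rewrite fE => /ev_continuous.
by apply: (@filterS _ (nbhs x) (nbhs_filter x)) => y /= fy _.
Qed.

Lemma measurable_gt0 : measurable [set x | forall i, Q i -> 0 < f i x].
Proof.
rewrite gt0E; apply: fin_bigcap_measurable => // i _.
have [p ->] := fp i.
rewrite (_ : mkset _ = setT `&` ev p @^-1` `]0, +oo[%classic).
  by apply: ev_measurable => //; exact: measurable_itv.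
by rewrite setTI; apply/seteqP; split => x /=; rewrite in_itv/= andbT.
Qed.

End positivity_sets.

(** * Barycentric coordinates and the geometry of simplices *)

Section simplex_geometry.
Context {R : realType} {d : nat} {V : finType} (pos : V -> 'rV[R]_d).
Implicit Types (e F S : {set V}) (x y : 'rV[R]_d) (w : V -> R).

(** No sign is imposed, so any point of the affine hull qualifies; the values of [w] off S are
    free. *)
Definition is_bary S x w :=
  \sum_(v in S) w v = 1 /\ x = \sum_(v in S) w v *: pos v.

(** Homogeneous coordinates: the column of ones makes one linear system out of the two conditions of
    [is_bary]. *)
Definition vertex_mx S : 'M[R]_(#|S|, 1 + d) :=
  \matrix_i row_mx (1 : 'rV_1) (pos (enum_val i)).

(* Meaningful when S has d + 1 affinely independent vertices; see [baryP]. *)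
Definition bary S x (v : V) : R := \sum_(i | enum_val i == v)
  (row_mx (1 : 'rV_1) x *m pinvmx (vertex_mx S)) ord0 i.

(** The coordinate is linear in (1, x): the row of [pinvmx] facing the 1 gives the constant term,
    the others the linear part. *)
Lemma bary_ev S v : exists p, bary S ^~ v = ev p.
Proof.
pose B := pinvmx (vertex_mx S).
exists (\sum_(i | enum_val i == v) (mpolyC d (B (lshift d ord0) i)
   + \sum_j B (rshift 1 j) i *: mpolyX R (mnm1 j))).
apply/funext => x; rewrite /bary /ev raddf_sum /=; apply: eq_bigr => i _.
rewrite mevalD mevalC raddf_sum mxE big_split_ord /= big_ord1.
rewrite row_mxEl mxE eqxx mul1r; congr (_ + _); apply: eq_bigr => j _.
by rewrite row_mxEr mevalZ mevalXU mulrC.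
Qed.

Lemma vertex_mxl S i : vertex_mx S i (lshift d ord0) = 1.
Proof. by rewrite mxE row_mxEl mxE eqxx. Qed.

Lemma vertex_mxr S i j : vertex_mx S i (rshift 1 j) = pos (enum_val i) ord0 j.
Proof. by rewrite mxE row_mxEr. Qed.

Lemma is_bary_mx S x w : is_bary S x w <->
  (\row_i w (enum_val i)) *m vertex_mx S = row_mx 1 x.
Proof.
have eL : \sum_(v in S) w v =
    ((\row_i w (enum_val i)) *m vertex_mx S) ord0 (lshift d ord0).
  rewrite mxE big_enum_val /=; apply: eq_bigr => i _.
  by rewrite mxE vertex_mxl mulr1.
have eR j : (\sum_(v in S) w v *: pos v) ord0 j =
    ((\row_i w (enum_val i)) *m vertex_mx S) ord0 (rshift 1 j).
  rewrite mxE summxE big_enum_val /=; apply: eq_bigr => i _.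
  by rewrite vertex_mxr !mxE.
split=> [[s1 xE]|E].
- apply/rowP => j; rewrite -[j]fintype.splitK; case: (fintype.split j) => k /=.
    by rewrite ord1 -eL row_mxEl mxE eqxx.
  by rewrite -eR -xE row_mxEr.
- split; first by rewrite eL E row_mxEl mxE eqxx.
  by apply/rowP => j; rewrite eR E row_mxEr.
Qed.

Section nondegenerate.
Variable e : {set V}.
Hypotheses (card_e : #|e| = d.+1) (ind_e : affinely_independent pos e).

Lemma is_bary_uniq x w w' : is_bary e x w -> is_bary e x w' ->
  {in e, w =1 w'}.
Proof.
move=> [s1 xE] [s1' xE'] v ve; apply/eqP; rewrite -subr_eq0; apply/eqP.
apply: (ind_e (w := fun v => w v - w' v)) => //.
  by rewrite sumrB s1 s1' subrr.
under eq_bigr do rewrite scalerBl.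
by rewrite sumrB -xE -xE' subrr.
Qed.

(** With d + 1 vertices the matrix is square, so full rank amounts to free rows, and a relation
    between the rows is an affine relation between the vertices. *)
Lemma vertex_mx_full : row_full (vertex_mx e).
Proof.
rewrite /row_full -[X in _ == X]/(d.+1) -card_e.
apply: inj_row_free => r r0.
(* The sum has one term for v in e and none elsewhere; it turns a row indexed by ordinals into
   weights on vertices. *)
pose w v := \sum_(i | enum_val i == v) r ord0 i.
have wE (i : 'I_#|e|) : w (enum_val i) = r ord0 i.
  rewrite /w (eq_bigl (pred1 i)) ?big_pred1_eq// => j /=.
  exact: inj_eq enum_val_inj _ _.
have rE : r = \row_i w (enum_val i) by apply/rowP => i; rewrite mxE wE.
apply/rowP => i; rewrite -wE mxE; apply: (ind_e (w := w)); last exact: enum_valP.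
- have := congr1 (fun M : 'rV_(1 + d) => M ord0 (lshift d ord0)) r0.
  rewrite !mxE => E; rewrite -[RHS]E big_enum_val; apply: eq_bigr => j _.
  by rewrite wE vertex_mxl mulr1.
- apply/rowP => k.
  have := congr1 (fun M : 'rV_(1 + d) => M ord0 (rshift 1 k)) r0.
  rewrite !mxE => E; rewrite -[RHS]E summxE big_enum_val; apply: eq_bigr => j _.
  by rewrite vertex_mxr !mxE wE.
Qed.

Lemma baryP x : is_bary e x (bary e x).
Proof.
apply/is_bary_mx; rewrite -[RHS](mulmxKpV (submx_full _ vertex_mx_full)).
congr (_ *m _); apply/rowP => i; rewrite mxE /bary.
rewrite (eq_bigl (pred1 i)) ?big_pred1_eq// => j /=.
exact: inj_eq enum_val_inj _ _.
Qed.

Lemma baryE x w v : v \in e -> is_bary e x w -> bary e x v = w v.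
Proof. by move=> ve wx; exact: is_bary_uniq (baryP x) wx v ve. Qed.

(** Uniqueness of the weights removes the existential and leaves polynomial inequalities, whence
    openness and measurability. *)
Lemma open_simplexE :
  open_simplex pos e = [set x | forall v, v \in e -> 0 < bary e x v].
Proof.
apply/seteqP; split => x /=.
  by move=> [w [w0 w1 xE]] v ve; rewrite (@baryE x w)// w0.
by move=> h; have [? ?] := baryP x; exists (bary e x).
Qed.

Lemma open_open_simplex : open (open_simplex pos e).
Proof. by rewrite open_simplexE; apply: open_gt0 => v; exact: bary_ev. Qed.

Lemma measurable_open_simplex : measurable (open_simplex pos e).
Proof. by rewrite open_simplexE; apply: measurable_gt0 => v; exact: bary_ev. Qed.

End nondegenerate.

Lemma is_bary_extend F e x w : F \subset e -> is_bary F x w ->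
  is_bary e x (fun v => if v \in F then w v else 0).
Proof.
move=> Fe [w1 xE]; split.
  rewrite -big_mkcondr (eq_bigl (mem F)) ?w1// => v /=.
  by rewrite -finset.in_setI (finset.setIidPr Fe).
under eq_bigr do rewrite (fun_if ( *:%R^~ _)) scale0r.
rewrite -big_mkcondr (eq_bigl (mem F)) ?xE// => v /=.
by rewrite -finset.in_setI (finset.setIidPr Fe).
Qed.

Lemma is_bary_line S x y w w' (t : R) : is_bary S x w -> is_bary S y w' ->
  is_bary S (x + t *: (y - x)) (fun v => w v + t * (w' v - w v)).
Proof.
move=> [w1 xE] [w'1 yE]; split.
  by rewrite big_split/= -mulr_sumr sumrB w1 w'1 subrr mulr0 addr0.
rewrite [in LHS]xE [in LHS]yE -sumrB scaler_sumr -big_split/=.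
by apply: eq_bigr => v _; rewrite -scalerBl scalerA scalerDl.
Qed.

Lemma bounded_open_simplex S : bounded_rV (open_simplex pos S).
Proof.
exists (\sum_(v in S) \sum_i `|pos v ord0 i|) => x [w [w0 w1 ->]] i.
rewrite summxE (le_trans (ler_norm_sum _ _ _))// ler_sum// => v vS.
rewrite mxE normrM (le_trans (y := `|pos v ord0 i|))//.
  apply: ler_piMl => //; rewrite (ger0_norm (ltW (w0 v vS))).
  rewrite -[leRHS]w1 (bigD1 v)//= lerDl sumr_ge0//.
  by move=> v' /andP[v'S _]; exact/ltW/w0.
by rewrite (bigD1 i)//= lerDl sumr_ge0.
Qed.

Lemma open_sub_closed_simplex S : open_simplex pos S `<=` closed_simplex pos S.
Proof. by move=> x [w [w0 w1 xE]]; exists w; split => // v /w0 /ltW. Qed.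

Lemma closed_simplex_subset F e : F \subset e ->
  closed_simplex pos F `<=` closed_simplex pos e.
Proof.
move=> Fe x [w [w0 w1 xE]]; have [e1 eE] := is_bary_extend Fe (conj w1 xE).
by exists (fun v => if v \in F then w v else 0); split => // v _; case: ifP => // /w0.
Qed.

(** Both memberships describe the same weights on e: positive on F by the first, zero off F' by the
    second. *)
Lemma open_closed_face e F F' x : affinely_independent pos e ->
  F \subset e -> F' \subset e -> open_simplex pos F x ->
  closed_simplex pos F' x -> F \subset F'.
Proof.
move=> ind_e Fe F'e [w [w0 w1 xE]] [w' [w'0 w'1 xE']].
have h := is_bary_uniq ind_e (is_bary_extend Fe (conj w1 xE))
  (is_bary_extend F'e (conj w'1 xE')).
apply/fintype.subsetP => v vF; have := h v (fintype.subsetP Fe v vF).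
rewrite /= vF; case: ifP => // _ w00.
by have := w0 v vF; rewrite w00 ltxx.
Qed.

(** Moving x slightly towards the barycenter [c] makes all weights positive. *)
Lemma closed_simplex_closure e : (0 < #|e|)%N ->
  closed_simplex pos e `<=` closure (open_simplex pos e).
Proof.
move=> e0 x [w [w0 w1 xE]] B Bx.
pose c := \sum_(v in e) (#|e|%:R^-1 : R) *: pos v.
have cP : is_bary e c (fun=> #|e|%:R^-1).
  by split=> //; rewrite sumr_const -[LHS]mulr_natl mulfV// pnatr_eq0 -lt0n.
have ct : (fun t : R => x + t *: (c - x)) @ (0 : R)^'+ --> x.
  apply: cvg_at_right_filter.
  have : (fun t : R => x + t *: (c - x)) @ (0 : R) --> x + (0 : R) *: (c - x).
    by apply: cvgD; [exact: cvg_cst|apply: cvgZr_tmp; exact: cvg_id].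
  by rewrite scale0r addr0.
near (0 : R)^'+ => t.
have t0 : 0 < t by near: t; exact: nbhs_right_gt.
have t1 : t <= 1 by near: t; exact: nbhs_right_le.
exists (x + t *: (c - x)); split; last by near: t; exact: ct.
have [s1 sE] := is_bary_line t (conj w1 xE) cP.
exists (fun v => w v + t * (#|e|%:R^-1 - w v)); split => // v ve.
(* The weight is rearranged as t / #|e| + (1 - t) w v, a positive term plus a nonnegative one. *)
rewrite mulrBr addrCA -mulrN1 -{1}[w v]mul1r (mulrC t (w v)) -mulrA.
rewrite ltr_pwDl// ?mulr_gt0 ?invr_gt0 ?ltr0n//.
by rewrite mul1r mulrN1 mulrN -[X in X - _]mulr1 -mulrBr mulr_ge0 ?w0// subr_ge0.
Unshelve. all: by end_near. Qed.

End simplex_geometry.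

(** * Divergence and traces of piecewise polynomial fields *)

Section piecewise_polynomial.
Context {R : realType} {d : nat}.
Implicit Types (D : set 'rV[R]_d) (u : 'rV[R]_d -> 'rV[R]_d).

Lemma divergence_ev D u (p : 'I_d -> mpoly d R) x : open D ->
  (forall y, D y -> forall i, u y ord0 i = ev (p i) y) -> D x ->
  divergence u x = \sum_i ev (mderiv i (p i)) x.
Proof.
move=> oD uE Dx; apply: eq_bigr => i _.
rewrite -(@derive_val _ _ _ _ _ _ _ (ev_is_derive (p i) i x)).
apply: near_eq_derive; apply: (@filterS _ (nbhs x) (nbhs_filter x) D).
  by move=> y Dy; exact: uE.
exact: open_nbhs_nbhs.
Qed.

(** The polynomial is continuous at x even when x lies outside D; membership in the closure makes
    the filter proper, so the limit is unique. *)
Lemma lim_ev D u (p : 'I_d -> mpoly d R) x : closure D x ->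
  (forall y, D y -> forall i, u y ord0 i = ev (p i) y) ->
  lim (u y @[y --> within D (nbhs x)]) = \row_i ev (p i) x.
Proof.
move=> Dx uE; have := @within_nbhs_proper _ D x Dx => PF.
apply: cvg_lim => //.
have pc : (fun y => \row_i ev (p i) y) @ x --> \row_i ev (p i) x.
  move=> B /nbhs_ballP[r /= r0 rB].
  have : nbhs x (fun y => forall i, ball (ev (p i) x) r (ev (p i) y)).
    apply: (@filter_forall _ _ 
      (fun i => [set y | ball (ev (p i) x) r (ev (p i) y)]) _ (nbhs_filter x)) => i.
    by apply: (@ev_continuous _ _ (p i) x); exact: nbhsx_ballx.
  apply: (@filterS _ (nbhs x) (nbhs_filter x)) => y h; apply: rB; split => // j i.
  by rewrite !mxE.
move=> B /pc; rewrite /nbhs /= /within /=.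
apply: (@filterS _ (nbhs x) (nbhs_filter x)) => y /= By Dy.
by rewrite (_ : u y = \row_i ev (p i) y)//; apply/rowP => i; rewrite mxE uE.
Qed.

End piecewise_polynomial.

(** * The dot product and Gram determinants *)

Section dot_product.
Context {R : realType} {d : nat}.
Implicit Types x y n : 'rV[R]_d.

Lemma dot_mx x y : dot x y = (x *m y^T) ord0 ord0.
Proof. by rewrite mxE; apply: eq_bigr => i _; rewrite mxE. Qed.

Lemma dotBl x y n : dot (x - y) n = dot x n - dot y n.
Proof. by rewrite !dot_mx mulmxBl mxE [in X in _ + X]mxE. Qed.

Lemma dotDr x y n : dot n (x + y) = dot n x + dot n y.
Proof. by rewrite !dot_mx linearD mulmxDr mxE. Qed.

Lemma dotZl (a : R) x y : dot (a *: x) y = a * dot x y.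
Proof. by rewrite !dot_mx -scalemxAl mxE. Qed.

Lemma dotZr (a : R) x y : dot x (a *: y) = a * dot x y.
Proof. by rewrite !dot_mx linearZ -scalemxAr mxE. Qed.

Lemma dotNr x n : dot n (- x) = - dot n x.
Proof. by rewrite -scaleN1r dotZr mulN1r. Qed.

Lemma dot_sumr (I : Type) (r : seq I) (Q : pred I) (f : I -> 'rV[R]_d) n :
  dot n (\sum_(i <- r | Q i) f i) = \sum_(i <- r | Q i) dot n (f i).
Proof.
apply: (big_morph (dot n)) => [x y|]; first exact: dotDr.
by rewrite /dot big1// => i _; rewrite mxE mulr0.
Qed.

Lemma dot_delta n i : dot n (delta_mx ord0 i) = n ord0 i.
Proof.
rewrite /dot (bigD1 i)//= mxE !eqxx mulr1 big1 ?addr0// => j ji.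
by rewrite mxE (negbTE ji) mulr0.
Qed.

Lemma dot_eq0 x : dot x x = 0 -> x = 0.
Proof.
move=> x0; apply/rowP => i; rewrite mxE; apply/eqP; rewrite -sqrf_eq0 expr2.
have := @psumr_eq0P _ _ predT (fun i => x ord0 i * x ord0 i).
by move=> -> // j _; rewrite -expr2 sqr_ge0.
Qed.

End dot_product.

(* Along the segment (1 - t) I + t A A^T the determinant never vanishes, and it
   is 1 at t = 0. *)
Lemma gram_det_gt0 (R : realType) m n (A : 'M[R]_(m, n)) : row_free A ->
  0 < \det (A *m A^T).
Proof.
move=> fA; pose G := A *m A^T.
have sq k (w : 'rV[R]_k) : 0 <= dot w w.
  by apply: sumr_ge0 => i _; rewrite -expr2 sqr_ge0.
(* A kernel vector v satisfies (1 - t)|v|^2 + t|vA|^2 = 0. For t < 1 this gives v = 0; for t = 1 it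
   gives vA = 0, and free rows give v = 0. *)
have unit_path (t : R) : 0 <= t -> t <= 1 -> \det ((1 - t)%:M + t *: G) != 0.
  move=> t0 t1; apply/negP => /det0P[v v0 vG].
  have : dot v (v *m ((1 - t)%:M + t *: G)) = 0.
    by rewrite vG /dot big1// => i _; rewrite mxE mulr0.
  have -> : dot v (v *m ((1 - t)%:M + t *: G)) =
      (1 - t) * dot v v + t * dot (v *m A) (v *m A).
    rewrite mulmxDr dotDr mul_mx_scalar dotZr -scalemxAr dotZr.
    by congr (_ + _ * _); rewrite !dot_mx !trmx_mul trmxK !mulmxA.
  move=> /eqP; rewrite paddr_eq0 ?mulr_ge0 ?subr_ge0// !mulf_eq0.
  move=> /andP[/orP[|/eqP/dot_eq0 vz]]; last by rewrite vz eqxx in v0.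
  rewrite subr_eq0 => /eqP <-; rewrite oner_eq0 /= => /eqP /dot_eq0 vA.
  have /row_freeP[B AB] := fA.
  by move: v0; rewrite -(mulmx1 v) -AB mulmxA vA mul0mx eqxx.
(* The path as a matrix of polynomials in t, so that its determinant is a polynomial to which
   [poly_ivt] applies. *)
pose M : 'M[{poly R}]_m := \matrix_(i, j) ((1 - 'X) *+ (i == j) + (G i j)%:P * 'X).
have ME t : (\det M).[t] = \det ((1 - t)%:M + t *: G).
  rewrite -horner_evalE -det_map_mx; congr (\det _).
  apply/matrixP => i j; rewrite !mxE /= horner_evalE !hornerE.
  by rewrite hornerMn !hornerE mulrC.
have -> : A *m A^T = (1 - 1)%:M + 1 *: G.
  by rewrite subrr scale1r -scalemx1 scale0r add0r.
rewrite lt_def unit_path//= leNgt; apply/negP => neg.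
(* The sign is flipped because [poly_ivt] expects a passage from nonpositive to nonnegative
   values. *)
have [|t /andP[t0 t1] /rootP] := @poly_ivt R (- \det M) 0 1 ler01.
  rewrite !hornerN !ME oppr_le0 oppr_ge0 (ltW neg) andbT.
  by rewrite subr0 scale0r addr0 det1 ler01.
by rewrite hornerN ME => /eqP; rewrite oppr_eq0; apply/negP; exact: unit_path.
Qed.

(** * The reference simplex *)

Section reference_simplex_theory.
Context {R : realType} {m : nat}.

(** [None] indexes the inequality on the sum, which puts all m + 1 constraints into one finite
    family. *)
Let f (o : option 'I_m) (s : 'rV[R]_m) : R :=
  if o is Some i then s ord0 i else 1 - \sum_i s ord0 i.

Let f_ev o : exists p, f o = ev p.
Proof.
case: o => [i|]; first by exists (mpolyX R (mnm1 i)); rewrite evX.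
exists (1 - \sum_i mpolyX R (mnm1 i)); apply/funext => s.
rewrite /f /ev mevalB meval1 (raddf_sum (meval _)) /=; congr (_ - _).
by apply: eq_bigr => i _; rewrite mevalXU.
Qed.

Let reference_simplexE :
  @reference_simplex R m = [set s | forall o, xpredT o -> 0 < f o s].
Proof.
apply/seteqP; split => s /=.
  by move=> [s0 s1] [i|] _ /=; rewrite ?subr_gt0// s0.
move=> h; split=> [i|]; first exact: (h (Some i) isT).
by have := h None isT; rewrite /= subr_gt0.
Qed.

Lemma open_reference_simplex : open (@reference_simplex R m).
Proof. by rewrite reference_simplexE; exact: open_gt0. Qed.

Lemma measurable_reference_simplex : measurable (@reference_simplex R m).
Proof. by rewrite reference_simplexE; exact: measurable_gt0. Qed.

Lemma bounded_reference_simplex : bounded_rV (@reference_simplex R m).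
Proof.
exists 1 => s [s0 s1] i; rewrite (ger0_norm (ltW (s0 i))).
rewrite (le_trans _ (ltW s1))// (bigD1 i)//= lerDl sumr_ge0// => j _.
exact/ltW/s0.
Qed.

End reference_simplex_theory.

(** * Facets and their surface integrals through the affine parametrization *)

Section facet_parametrization.
Context {R : realType} {d : nat} {V : finType} (pos : V -> 'rV[R]_d).

Lemma affinely_independentS (e F : {set V}) : F \subset e ->
  affinely_independent pos e -> affinely_independent pos F.
Proof.
move=> Fe ind_e w w0 wx v vF.
have FE (W : zmodType) (G : V -> W) :
    \sum_(v in F) G v = \sum_(v in e) (if v \in F then G v else 0).
  rewrite -big_mkcondr; apply: eq_bigl => y.
  by rewrite -finset.in_setI (finset.setIidPr Fe).
have := ind_e (fun v => if v \in F then w v else 0) _ _ v (fintype.subsetP Fe v vF).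
rewrite /= vF; apply; first by rewrite -FE.
by rewrite -[RHS]wx FE; apply: eq_bigr => y _; case: ifP; rewrite ?scale0r.
Qed.

Variables (F : {set V}).
Hypotheses (d_gt0 : (0 < d)%N) (card_F : #|F| = d).
Implicit Types (s : 'rV[R]_d.-1) (x : 'rV[R]_d).

(** A default value for [nth]; the inner default is itself a vertex of F, available because d >
    0. *)
Let v0 : V := head (enum_val (cast_ord (esym card_F) (Ordinal d_gt0))) (enum F).
Let vtx (j : nat) := nth v0 (enum F) j.

Let size_F : size (enum F) = d.
Proof. by rewrite -cardE. Qed.

Let lt_d (i : 'I_d.-1) : (i.+1 < d)%N.
Proof. by rewrite -[ltnRHS](prednK d_gt0) ltnS ltn_ord. Qed.

Let vtx_in j : (j < d)%N -> vtx j \in F.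
Proof. by move=> jd; rewrite -mem_enum mem_nth// size_F. Qed.

Let sum_facet (W : nmodType) (G : V -> W) :
  \sum_(v in F) G v = G (vtx 0) + \sum_(i < d.-1) G (vtx i.+1).
Proof.
rewrite -big_enum (big_nth v0) size_F -[in LHS](prednK d_gt0).
by rewrite big_nat_recl// big_mkord.
Qed.

(* Total weight c; c = 1 gives the barycentric coordinates of [facet_map s],
   c = 0 the linear combination [s *m facet_edges]. *)
Let weight (c : R) s (v : V) : R :=
  if index v (enum F) is j.+1 then \sum_(i < d.-1 | val i == j) s ord0 i
  else c - \sum_i s ord0 i.

Let weight0 c s : weight c s (vtx 0) = c - \sum_i s ord0 i.
Proof. by rewrite /weight index_uniq ?enum_uniq ?size_F. Qed.

Let weightS c s (i : 'I_d.-1) : weight c s (vtx i.+1) = s ord0 i.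
Proof.
rewrite /weight index_uniq ?enum_uniq ?size_F//.
by rewrite (eq_bigl (pred1 i)) ?big_pred1_eq.
Qed.

Let vertexE j : (j < d)%N -> (facet_vertices pos F)`_j = pos (vtx j).
Proof. by move=> jd; rewrite (nth_map v0) ?size_F. Qed.

Let sum_weight c s : \sum_(v in F) weight c s v = c.
Proof.
rewrite sum_facet; under eq_bigr do rewrite weightS.
by rewrite weight0 subrK.
Qed.

Let sum_weight_pos c s : \sum_(v in F) weight c s v *: pos v =
  c *: pos (vtx 0) + s *m facet_edges pos F.
Proof.
rewrite sum_facet /=; under eq_bigr do rewrite weightS.
rewrite weight0 mulmx_sum_row; under [in RHS]eq_bigr => i _ do
  rewrite rowK !vertexE// scalerBr.
by rewrite sumrB -scaler_suml scalerBl addrA addrAC.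
Qed.

(** A relation between edges is an affine relation between vertices of total weight 0, the base
    vertex taking minus the sum of the coefficients. *)
Lemma facet_edges_free : affinely_independent pos F ->
  row_free (facet_edges pos F).
Proof.
move=> ind_F; apply: inj_row_free => s s0; apply/rowP => i.
rewrite mxE -(weightS 0); apply: ind_F; last exact: vtx_in.
  exact: sum_weight.
by rewrite sum_weight_pos s0 scale0r addr0.
Qed.

Lemma facet_map_open_simplex s : reference_simplex s ->
  open_simplex pos F (facet_map pos F s).
Proof.
move=> [s0 s1]; exists (weight 1 s); split; last 1 first.
- by rewrite sum_weight_pos scale1r /facet_map vertexE.
- move=> v vF; have vj : (index v (enum F) < d)%N.
    by rewrite -size_F index_mem mem_enum.
  rewrite -(nth_index v0 (s := enum F) (x := v)) ?mem_enum// -/(vtx _).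
  case: (index v (enum F)) vj => [|j] jd; first by rewrite weight0 subr_gt0.
  have jd' : (j < d.-1)%N by rewrite -ltnS (prednK d_gt0).
  by rewrite (weightS 1 s (Ordinal jd')).
- exact: sum_weight.
Qed.

(** Brings a vanishing proved on the reference simplex back to every point of the facet; the
    parameters are the weights of the vertices other than the base one. *)
Lemma facet_map_onto x : open_simplex pos F x ->
  exists2 s, reference_simplex s & facet_map pos F s = x.
Proof.
move=> [w [w0 w1 xE]]; pose s : 'rV[R]_d.-1 := \row_i w (vtx i.+1).
have sE : \sum_i s ord0 i = 1 - w (vtx 0).
  rewrite -w1 sum_facet [RHS]addrC addKr; apply: eq_bigr => i _.
  by rewrite mxE.
exists s.
  split=> [i|]; first by rewrite mxE w0 ?vtx_in.
  by rewrite sE ltrBlDr ltrDl w0 ?vtx_in.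
rewrite /facet_map vertexE// -[pos _]scale1r -sum_weight_pos xE !sum_facet weight0.
rewrite sE subKr; congr (_ + _); apply: eq_bigr => i _.
by rewrite weightS mxE.
Qed.

Lemma ev_facet_map p : exists q, forall s, ev p (facet_map pos F s) = ev q s.
Proof.
exists (comp_mpoly [tuple mpolyC _ ((facet_vertices pos F)`_0 ord0 j) +
   \sum_i facet_edges pos F i j *: mpolyX R (mnm1 i) | j < d] p) => s.
rewrite /ev comp_mpoly_meval; apply: meval_eq => j.
rewrite tnth_mktuple mevalD mevalC raddf_sum /facet_map !mxE; congr (_ + _).
by apply: eq_bigr => i _; rewrite /= mevalZ mevalXU mulrC.
Qed.

Lemma eq_facet_integral f g : (forall x, open_simplex pos F x -> f x = g x) ->
  facet_integral pos F f = facet_integral pos F g.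
Proof.
move=> fg; congr (_ * _); apply: eq_Rintegral => s; rewrite inE => sr.
exact/fg/facet_map_open_simplex.
Qed.

(** The degree is dropped: additivity of the facet integral only needs integrability. *)
Definition polynomial_on (D : set 'rV[R]_d) f :=
  exists p, forall x, D x -> f x = ev p x.

Lemma facet_integral0 : facet_integral pos F (fun=> 0) = 0.
Proof.
rewrite /facet_integral Rintegral_cst ?mul0r ?mulr0//.
exact: measurable_reference_simplex.
Qed.

Lemma facet_integralD f g : polynomial_on (open_simplex pos F) f ->
  polynomial_on (open_simplex pos F) g ->
  facet_integral pos F (fun x => f x + g x) =
  facet_integral pos F f + facet_integral pos F g.
Proof.
have mr := @measurable_reference_simplex R d.-1.
move=> [p fp] [q gq]; rewrite (eq_facet_integral fp) (eq_facet_integral gq).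
rewrite (@eq_facet_integral _ (fun x => ev p x + ev q x)); last first.
  by move=> x Fx; rewrite fp ?gq.
have [p' pE] := ev_facet_map p; have [q' qE] := ev_facet_map q.
rewrite /facet_integral -mulrDr -RintegralD//.
- rewrite (_ : EFin \o _ = EFin \o ev p'); last by apply/funext => s /=; rewrite pE.
  exact: ev_integrable bounded_reference_simplex.
- rewrite (_ : EFin \o _ = EFin \o ev q'); last by apply/funext => s /=; rewrite qE.
  exact: ev_integrable bounded_reference_simplex.
Qed.

Lemma polynomial_on_sum D (I : Type) (r : seq I) (Q : pred I)
    (f : I -> 'rV[R]_d -> R) : (forall i, Q i -> polynomial_on D (f i)) ->
  polynomial_on D (fun x => \sum_(i <- r | Q i) f i x).
Proof.
move=> fp; elim: r => [|i r [p IH]].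
  by exists 0 => x _; rewrite big_nil /ev meval0.
have [Qi|Qi] := boolP (Q i); last first.
  by exists p => x Dx; rewrite big_cons (negbTE Qi) IH.
have [q qE] := fp i Qi; exists (q + p) => x Dx.
by rewrite big_cons Qi evD qE// IH.
Qed.

Lemma facet_integral_sum (I : Type) (r : seq I) (Q : pred I)
    (f : I -> 'rV[R]_d -> R) :
  (forall i, Q i -> polynomial_on (open_simplex pos F) (f i)) ->
  facet_integral pos F (fun x => \sum_(i <- r | Q i) f i x) =
  \sum_(i <- r | Q i) facet_integral pos F (f i).
Proof.
move=> fp; elim: r => [|i r IH].
  rewrite big_nil -[RHS]facet_integral0; apply: eq_facet_integral => x _.
  by rewrite big_nil.
rewrite big_cons; case: ifP => Qi; last first.
  by rewrite -IH; apply: eq_facet_integral => x _; rewrite big_cons Qi.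
rewrite -IH -facet_integralD; [|exact: fp|exact: polynomial_on_sum].
by apply: eq_facet_integral => x _; rewrite big_cons Qi.
Qed.

Lemma facet_integral_sqr_eq0 f (c : R) : affinely_independent pos F ->
  c != 0 -> polynomial_on (open_simplex pos F) f ->
  facet_integral pos F (fun x => c * (f x * f x)) = 0 ->
  forall x, open_simplex pos F x -> f x = 0.
Proof.
have mr := @measurable_reference_simplex R d.-1.
have br := @bounded_reference_simplex R d.-1.
move=> ind_F c0 [p fp]; have [q qE] := ev_facet_map p => I0 x Fx.
have [s sr <-] := facet_map_onto Fx.
rewrite fp ?qE; last exact: facet_map_open_simplex.
apply: ev_sqr_integral_eq0 sr => //; first exact: open_reference_simplex.
have e2 t : ev (q ^+ 2) t = ev q t ^+ 2 by rewrite expr2 evM.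
(* The surface factor is positive because the edges are independent, so the integral over the
   reference simplex is the one that vanishes. *)
move/eqP: I0; rewrite mulf_eq0 gt_eqF ?sqrtr_gt0 ?gram_det_gt0 ?facet_edges_free//=.
rewrite (@eq_Rintegral _ _ _ _ _ (fun t => c * ev (q ^+ 2) t)); last first.
  move=> t; rewrite inE => tr.
  by rewrite fp ?qE ?e2 ?expr2//; exact: facet_map_open_simplex.
rewrite RintegralZl//; last exact: ev_integrable.
rewrite mulf_eq0 (negbTE c0) /= => /eqP <-.
by apply: eq_Rintegral => t _; rewrite e2.
Qed.

End facet_parametrization.

(** * Faces and normals in the mesh *)

Lemma facet_opposite d (V : finType) (e F : {set V}) :
  #|e| = d.+1 -> F \in facets_of d e -> exists2 a, a \notin F & e = a |: F.
Proof.
move=> card_e; rewrite inE => /andP[Fe /eqP card_F].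
have /eqP/cards1P[a aE] : #|e :\: F| = 1%N.
  by rewrite cardsD (finset.setIidPr Fe) card_e card_F subSnn.
exists a.
  have : a \in e :\: F by rewrite aE finset.set11.
  by rewrite inE => /andP[].
by rewrite -aE finset.setUC -[LHS](finset.setID e F) (finset.setIidPr Fe).
Qed.

(** As the weights sum to 1, x - f0 is the weighted sum of the v - f0, and only the vertex [a]
    opposite to F is not orthogonal to n. The height over the facet is thus a multiple of one
    barycentric coordinate. *)
Lemma dot_facet_normal (R : realType) d (V : finType) (pos : V -> 'rV[R]_d)
    e F (n x : 'rV[R]_d) a f0 w : e = a |: F -> a \notin F -> f0 \in F ->
  (forall v v', v \in F -> v' \in F -> dot n (pos v - pos v') = 0) ->
  is_bary pos e x w -> dot n (x - pos f0) = w a * dot n (pos a - pos f0).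
Proof.
move=> eE aF f0F n0 [w1 xE].
have -> : x - pos f0 = \sum_(v in e) w v *: (pos v - pos f0).
  under eq_bigr do rewrite scalerBr.
  by rewrite sumrB -xE -scaler_suml w1 scale1r.
rewrite dot_sumr eE big_setU1//= dotZr big1 ?addr0// => v vF.
by rewrite dotZr n0 ?mulr0.
Qed.

Section mesh.
Context {R : realType} {d : nat} {Omega : set 'rV[R]_d}.
Variable T : triangulation Omega.
Local Notation pos := (@pos _ _ _ T).
Implicit Types e F : {set vertex T}.

(** A common point lies in the closed simplex of e :&: e', which forces F' into e as well; then both
    are faces of the same nondegenerate simplex and [open_closed_face] applies both ways. *)
Lemma open_faces_disjoint e e' F F' x : e \in elements T -> e' \in elements T ->
  F \subset e -> F' \subset e' -> open_simplex pos F x -> open_simplex pos F' x ->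
  F = F'.
Proof.
move=> eT e'T Fe F'e' Fx F'x.
have cx : closed_simplex pos (e :&: e') x.
  rewrite -elements_meet//; split.
  - exact/(closed_simplex_subset Fe)/open_sub_closed_simplex.
  - exact/(closed_simplex_subset F'e')/open_sub_closed_simplex.
have ind_e := element_nondegenerate eT.
have ind_e' := element_nondegenerate e'T.
have F'I : F' \subset e :&: e'.
  exact: open_closed_face ind_e' F'e' (subsetIr _ _) F'x cx.
have F'e : F' \subset e by apply: fintype.subset_trans F'I (subsetIl _ _).
apply/eqP; rewrite finset.eqEsubset; apply/andP; split.
- exact: open_closed_face ind_e Fe F'e Fx (open_sub_closed_simplex F'x).
- exact: open_closed_face ind_e F'e Fe F'x (open_sub_closed_simplex Fx).
Qed.

Lemma opposite_normals (d_gt0 : (0 < d)%N) ep em F np nm :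
  ep \in elements T -> em \in elements T -> ep <> em ->
  F \in facets_of d ep -> F \in facets_of d em ->
  is_outward_unit_normal pos ep F np -> is_outward_unit_normal pos em F nm ->
  nm = - np.
Proof.
move=> epT emT epm Fp Fm hp hm.
have [a aF epE] := facet_opposite (element_card epT) Fp.
have [b bF emE] := facet_opposite (element_card emT) Fm.
have [Fep /eqP card_F] : F \subset ep /\ #|F| == d.
  by move: Fp; rewrite inE => /andP.
have [f0 f0F] : exists f0, f0 \in F by apply/card_gt0P; rewrite card_F.
have bp x := baryP (element_card epT) (element_nondegenerate epT) x.
have bm x := baryP (element_card emT) (element_nondegenerate emT) x.
have [np1 np0 npn] := hp; have [nm1 nm0 nmn] := hm.
set cp := dot np (pos a - pos f0).
have cp0 : cp < 0 by apply: npn => //; rewrite epE !inE eqxx.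
pose c := dot nm (pos a - pos f0).
have npE x : dot np (x - pos f0) = bary pos ep x a * cp.
  exact: dot_facet_normal epE aF f0F np0 (bp x).
have nmE x : dot nm (x - pos f0) = bary pos ep x a * c.
  exact: dot_facet_normal epE aF f0F nm0 (bp x).
have nmb x : dot nm (x - pos f0) = bary pos em x b * dot nm (pos b - pos f0).
  exact: dot_facet_normal emE bF f0F nm0 (bm x).
(* Both heights are multiples of the same coordinate of [ep]; evaluating them at f0 plus each basis
   vector compares the entries. *)
have prop : cp *: nm = c *: np.
  apply/rowP => i; rewrite !mxE -!dot_delta.
  rewrite -[delta_mx _ _](addrK (pos f0)) npE nmE.
  by rewrite mulrCA [RHS]mulrCA (mulrC cp).
(* Unit length on both sides of [prop] gives c^2 = cp^2; the root c = - cp is the claim, c = cp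
   means equal normals. *)
have : (c - cp) * (c + cp) = 0.
  rewrite -subr_sqr; apply/eqP; rewrite subr_eq0; apply/eqP.
  have := congr1 (fun v => dot v v) prop; rewrite !dotZl !dotZr np1 nm1.
  by rewrite !mulr1 -!expr2 => ->.
move/eqP; rewrite mulf_eq0 subr_eq0 addr_eq0 => /orP[/eqP cE|/eqP cE]; last first.
  move: prop; rewrite cE scaleNr -scalerN => /(scalerI _); apply.
  by rewrite lt_eqF.
exfalso.
pose m := \sum_(v in F) (d%:R^-1 : R) *: pos v.
have dR0 : 0 < (d%:R : R)^-1 by rewrite invr_gt0 ltr0n.
have mP : is_bary pos F m (fun=> d%:R^-1).
  by split=> //; rewrite sumr_const card_F -[LHS]mulr_natl mulfV// pnatr_eq0 -lt0n.
have Fem : F \subset em by rewrite emE; exact: finset.subsetUr.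
have em_m : closure (open_simplex pos em) m.
  apply: closed_simplex_closure; first by rewrite (element_card emT).
  apply: (closed_simplex_subset Fem); exists (fun=> d%:R^-1).
  by case: mP => ? ?; split => // v _; exact: ltW.
(* Were the normals equal, the points of em close to the barycenter of F would
   have positive barycentric coordinates in ep, and the two would overlap. *)
have oU := @open_gt0 R d _ (mem F) (fun v x => bary pos ep x v) (bary_ev pos ep).
have Um : forall v, v \in F -> 0 < bary pos ep m v.
  move=> v vF; rewrite (baryE (element_card epT) (element_nondegenerate epT)
    (fintype.subsetP Fep v vF) (is_bary_extend Fep mP)).
  by rewrite vF.
have [y [emy Uy]] := em_m _ (open_nbhs_nbhs (conj oU Um)).
have epy : open_simplex pos ep y.
  rewrite (open_simplexE (element_card epT) (element_nondegenerate epT)) => v.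
  rewrite {1}epE in_setU1 => /orP[/eqP->|]; last exact: Uy.
  (* As y lies in [em], its height is negative; it is also the [a]-coordinate of y in [ep] times c =
     cp < 0, so that coordinate is positive. *)
  have : dot nm (y - pos f0) < 0.
    rewrite nmb pmulr_rlt0; last first.
      have /= := emy.
      rewrite (open_simplexE (element_card emT) (element_nondegenerate emT)).
      by apply; rewrite emE setU11.
    by apply: nmn => //; rewrite emE setU11.
  by rewrite nmE cE nmulr_llt0.
exact/epm/(open_faces_disjoint epT emT (subxx _) (subxx _) epy emy).
Qed.

Lemma square_integrable_ev n (D : set 'rV[R]_n) p f : measurable D ->
  bounded_rV D -> (forall x, D x -> f x = ev p x) -> square_integrable D f.
Proof.
move=> mD bD fE; split.
  apply: (eq_measurable_fun (ev p)); first by move=> x; rewrite inE => /fE.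
  exact: measurable_funS (ev_measurable p).
rewrite (@eq_integral _ _ _ _ _ (EFin \o ev (p ^+ 2)%R)).
  have /integrable_fin_num := ev_integrable (p ^+ 2) mD bD.
  by move=> /(_ mD); rewrite fin_numE => /andP[_ ?]; rewrite ltey.
by move=> x; rewrite inE => Dx; rewrite /= fE// [in RHS]expr2 evM.
Qed.

Lemma element_ev k u e : V_h T k u -> e \in elements T ->
  exists2 p : 'I_d -> mpoly d R, forall i, (msize (p i) <= k.+1)%N &
    forall x, element e x -> forall i, u x ord0 i = ev (p i) x.
Proof.
move=> uV eT.
have /choice[p pP] : forall i, exists p : mpoly d R, (msize p <= k.+1)%N /\
    forall x, element e x -> u x ord0 i = ev p x.
  by move=> i; have [_ /(_ e eT)[p pk pE]] := uV i; exists p.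
by exists p => [i|x ex i]; [case: (pP i)|case: (pP i) => _; exact].
Qed.

Lemma facet_closure e F x : e \in elements T -> F \subset e ->
  facet F x -> closure (element e) x.
Proof.
move=> eT Fe Fx; apply: closed_simplex_closure.
  by rewrite (element_card eT).
exact/(closed_simplex_subset Fe)/open_sub_closed_simplex.
Qed.

Lemma P_trace k u e F i : V_h T k u -> e \in elements T -> F \subset e ->
  P_ k (facet F) (fun x => trace e u x ord0 i).
Proof.
move=> uV eT Fe; have [p pk pE] := element_ev uV eT.
exists (p i) => // x Fx.
by rewrite /trace (lim_ev (facet_closure eT Fe Fx) pE) mxE.
Qed.

End mesh.

(** * Testing the two equations *)

Section incompressibility.
Context {R : realType} {d : nat} {Omega : set 'rV[R]_d}.
Variable T : triangulation Omega.
Local Notation pos := (@pos _ _ _ T).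
Implicit Types (e F : {set vertex T}) (u : 'rV[R]_d -> 'rV[R]_d).

Let mE e : e \in elements T -> measurable (element e).
Proof.
by move=> eT; exact: measurable_open_simplex (element_card eT) (element_nondegenerate eT).
Qed.

Let oE e : e \in elements T -> open (element e).
Proof.
by move=> eT; exact: open_open_simplex (element_card eT) (element_nondegenerate eT).
Qed.

Lemma Q_h_patch k e p : e \in elements T -> (msize p <= k.-1.+1)%N ->
  Q_h T k (ev p \_ (element e)).
Proof.
move=> eT pk; split; [split|].
- apply: measurable_funTS; apply/(measurable_restrictT _ (mE eT)).
  exact: measurable_funS (ev_measurable p).
- rewrite [ltLHS](_ : _ = \int[lebesgue_rV]_(x in element e) ((ev p x) ^+ 2)%:E)%E.
    by have [] := square_integrable_ev (mE eT) (bounded_open_simplex _ _)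
      (fun x _ => erefl (ev p x)).
  rewrite integral_mkcond [RHS]integral_mkcond; congr (integral _ _ _).
  (* Over the whole space the two integrands agree: the patch is zero off the element, and the
     element is contained in Omega. *)
  apply/funext => x; rewrite /patch; case: ifPn => xO; case: ifPn => xe //.
    by rewrite expr0n.
  by exfalso; move: xO; rewrite (mem_set (element_sub eT (set_mem xe))).
- move=> e' e'T; have [->|ee'] := eqVneq e' e.
    by exists p => // x ex; rewrite patchT ?inE.
  apply: P_eq (P_0 _ _) => x e'x; rewrite patchN//; apply/negP; rewrite inE => ex.
  by move/eqP: ee'; apply; exact: open_faces_disjoint e'T eT (subxx _) (subxx _) e'x ex.
Qed.

Lemma divergence_free rho k u : 0 < rho -> (1 <= k)%N -> V_h T k u ->
  (forall q, Q_h T k q ->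
    \sum_(e in elements T)
      \int[lebesgue_rV]_(x in element e) (rho^-1 * divergence u x * q x) = 0) ->
  forall e, e \in elements T -> forall x, element e x -> divergence u x = 0.
Proof.
move=> rho0 k1 uV mass e eT x ex.
have [p pk pE] := element_ev uV eT.
pose g := \sum_i mderiv i (p i).
have gE y : element e y -> divergence u y = ev g y.
  by move=> ey; rewrite (divergence_ev (oE eT) pE ey) /ev raddf_sum.
have gk : (msize g <= k.-1.+1)%N.
  (* As k is positive, k.-1.+1 is k, exactly the bound left after differentiation. *)
  rewrite prednK// (leq_trans (msize_sum _ _ _))//.
  by apply/bigmax_leqP => i _; exact: msize_mderiv.
rewrite gE//; apply: (ev_sqr_integral_eq0 (mE eT) (oE eT) (bounded_open_simplex _ _)) ex.
have := mass _ (Q_h_patch eT gk).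
rewrite (bigD1 e)//= [X in _ + X]big1 ?addr0; last first.
  move=> e' /andP[e'T ee']; rewrite (@eq_Rintegral _ _ _ _ _ (cst 0)).
    by rewrite Rintegral_cst ?mul0r//; exact: mE.
  move=> y; rewrite inE => e'y; rewrite patchN ?mulr0//; apply/negP; rewrite inE => ey.
  by move/eqP: ee'; apply; exact: open_faces_disjoint e'T eT (subxx _) (subxx _) e'y ey.
rewrite (@eq_Rintegral _ _ _ _ _ (fun y => rho^-1 * ev (g ^+ 2) y)); last first.
  by move=> y; rewrite inE => ey; rewrite patchT ?inE// gE// expr2 evM mulrA.
rewrite RintegralZl; last 2 first.
- exact: mE.
- by apply: ev_integrable; [exact: mE|exact: bounded_open_simplex].
move/eqP; rewrite mulf_eq0 invr_eq0 (gt_eqF rho0)/= => /eqP <-.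
by apply: eq_Rintegral => y _; rewrite !expr2 evM.
Qed.

Lemma facets_of_facet e F : e \in elements T -> F \in facets_of d e -> F \in facets T.
Proof. by move=> eT Fe; apply/bigcupP; exists e. Qed.

(** Summing over all elements that contain F handles boundary and interior facets by the same test
    function. *)
Lemma facet_normal_balance (d_gt0 : (0 < d)%N) n rho k u uhat F :
  0 < rho -> V_h T k u -> Vhat_h T k uhat -> F \in facets T ->
  (forall q, Qhat_h T k q ->
    \sum_(e in elements T) \sum_(F' in facets_of d e)
      facet_integral pos F'
        (fun x => rho^-1 * dot (trace e u x - uhat x) (n e F') * q x) = 0) ->
  forall x, facet F x ->
  \sum_(e in elements T | F \in facets_of d e)
    dot (trace e u x - uhat x) (n e F) = 0.
Proof.
move=> rho0 uV hV FT mass.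
pose r e x := dot (trace e u x - uhat x) (n e F).
pose g x := \sum_(e in elements T | F \in facets_of d e) r e x.
have cardF F' : F' \in facets T -> #|F'| = d.
  by move=> /finset.bigcupP[e _]; rewrite inE => /andP[_ /eqP].
have rP e : (e \in elements T) && (F \in facets_of d e) -> P_ k (facet F) (r e).
  move=> /andP[eT]; rewrite inE => /andP[Fe _].
  apply: P_sum => i _; apply: P_scale.
  have [_ /(_ F FT) hP] := hV i.
  apply: P_eq (P_add (P_trace i uV eT Fe) (P_scale (-1) hP)) => x _.
  by rewrite !mxE mulrN1.
have [p pk gE] : P_ k (facet F) g by apply: P_sum => e; exact: rP.
have ind_F : affinely_independent pos F.
  have /finset.bigcupP[e eT] := FT; rewrite inE => /andP[Fe _].
  exact: affinely_independentS Fe (element_nondegenerate eT).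
have disj F' x : F' \in facets T -> facet F x -> facet F' x -> F' = F.
  move=> F'T Fx F'x; have /finset.bigcupP[e eT] := FT.
  rewrite inE => /andP[Fe _]; have /finset.bigcupP[e' e'T] := F'T.
  rewrite inE => /andP[F'e' _].
  exact: open_faces_disjoint e'T eT F'e' Fe F'x Fx.
have gQ : Qhat_h T k (g \_ (facet F)).
  have gP F' : F' \in facets T -> exists2 p' : mpoly d R, (msize p' <= k.+1)%N &
      forall x, facet F' x -> (g \_ (facet F)) x = ev p' x.
    move=> F'T; have [->|FF'] := eqVneq F' F.
      by exists p => // x Fx; rewrite patchT ?inE// gE.
    exists 0 => [|x F'x]; first by rewrite msize0.
    rewrite patchN ?/ev ?meval0//; apply/negP; rewrite inE => Fx.
    by move/eqP: FF'; apply; exact: disj Fx F'x.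
  split=> F' F'T; have [p' p'k p'E] := gP F' F'T; last by exists p'.
  have [q qE] := ev_facet_map pos F' p'.
  apply: (square_integrable_ev (p := q) measurable_reference_simplex
    bounded_reference_simplex) => s sr.
  rewrite -qE /= p'E//; apply: facet_map_open_simplex => //; exact: cardF.
(* Polynomial integrands allow the sum over elements to pass under the facet integral. *)
have polyr e : (e \in elements T) && (F \in facets_of d e) ->
    polynomial_on (facet F) (fun x => rho^-1 * r e x * (g \_ (facet F)) x).
  move=> /rP[q _ qE]; exists (rho^-1 *: (q * p)) => x Fx.
  by rewrite /ev mevalZ mevalM patchT ?inE// qE// gE// mulrA.
apply: (@facet_integral_sqr_eq0 _ _ _ pos F d_gt0 (cardF F FT) g rho^-1) => //.
- by rewrite invr_eq0 gt_eqF.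
- by exists p.
rewrite -[RHS](mass _ gQ).
(* In the tested equation each element contributes only its term at F, if it has that facet; the
   remaining sum is the integral of g^2 / rho over F. *)
rewrite (eq_bigr (fun e => if F \in facets_of d e then
    facet_integral pos F (fun x => rho^-1 * r e x * (g \_ (facet F)) x) else 0)).
  rewrite -big_mkcondr -facet_integral_sum//; last exact: cardF.
  apply: eq_facet_integral => //; first exact: cardF.
  move=> x Fx; rewrite -mulr_suml -mulr_sumr patchT ?inE//.
  by rewrite -/(g x) mulrA.
move=> e eT; have other F' : F' \in facets_of d e -> F' != F ->
    facet_integral pos F' (fun x => rho^-1 * dot (trace e u x - uhat x) (n e F')
      * (g \_ (facet F)) x) = 0.
  move=> F'e FF'; have F'T := facets_of_facet eT F'e.
  rewrite -[RHS](facet_integral0 pos F').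
  apply: eq_facet_integral => //; first exact: cardF.
  move=> x F'x; rewrite patchN ?mulr0//; apply/negP; rewrite inE => Fx.
  by move/eqP: FF'; apply; exact: disj Fx F'x.
case: ifP => Fe.
  by rewrite (bigD1 F)//= big1 ?addr0// => F' /andP[? ?]; exact: other.
by rewrite big1// => F' F'e; apply: other => //; apply: contraFN Fe => /eqP <-.
Qed.

End incompressibility.

Theorem proposition2 (R : realType) (d : nat) (hd : d = 2%N \/ d = 3%N)
  (Omega : set 'rV[R]_d) (Omega_nonempty : Omega !=set0)
  (Omega_open : open Omega) (Omega_connected : connected Omega)
  (Omega_bounded : bounded_set Omega)
  (rho : R) (rho_gt0 : 0 < rho)
  (T : triangulation Omega)
  (n : {set vertex T} -> {set vertex T} -> 'rV[R]_d)
  (n_outward : forall e F, e \in elements T -> F \in facets_of d e ->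
    is_outward_unit_normal (@pos _ _ _ T) e F (n e F))
  (k : nat) (k_ge1 : (1 <= k)%N)
  (u uhat : 'rV[R]_d -> 'rV[R]_d) (u_V : V_h T k u) (uhat_V : Vhat_h T k uhat)
  (mass : forall q, Q_h T k q ->
    \sum_(e in elements T)
      \int[lebesgue_rV]_(x in element e) (rho^-1 * divergence u x * q x) = 0)
  (mass_facets : forall q, Qhat_h T k q ->
    \sum_(e in elements T) \sum_(F in facets_of d e)
      facet_integral (@pos _ _ _ T) F
        (fun x => rho^-1 * dot (trace e u x - uhat x) (n e F) * q x) = 0) :
  [/\ forall e, e \in elements T -> forall x, element e x -> divergence u x = 0,
      forall F, interior_facet F -> forall ep em,
        ep \in elements T -> em \in elements T -> ep <> em ->
        F \in facets_of d ep -> F \in facets_of d em ->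
        forall x, facet F x -> normal_jump n ep em F u x = 0 &
      forall F, boundary_facet F -> forall e,
        e \in elements T -> F \in facets_of d e ->
        forall x, facet F x -> dot (trace e u x) (n e F) = dot (uhat x) (n e F)].
Proof.
have d_gt0 : (0 < d)%N by case: hd => ->.
(* The mesh axioms count the elements that include F, the balance sums over those having F as a
   facet; since F has d vertices these agree. *)
have sharing e F : F \in facets_of d e ->
    [set e' in elements T | F \in facets_of d e'] =
    [set e' in elements T | F \subset e']%SET.
  rewrite inE => /andP[_ card_F].
  by apply/setP => e'; rewrite !inE card_F andbT.
have balance e F x : e \in elements T -> F \in facets_of d e -> facet F x ->
    \sum_(e' in [set e' in elements T | F \subset e']%SET)
      dot (trace e' u x - uhat x) (n e' F) = 0.
  move=> eT Fe Fx.
  rewrite -[RHS](facet_normal_balance d_gt0 rho_gt0 u_V uhat_V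
    (facets_of_facet eT Fe) mass_facets Fx).
  by rewrite -(sharing e F)//; apply: eq_bigl => e'; rewrite inE.
split.
- exact: divergence_free rho_gt0 k_ge1 u_V mass.
- move=> F [FT F_int] ep em epT emT epm Fep Fem x Fx.
  have n_opp : n em F = - n ep F.
    exact: opposite_normals epT emT epm Fep Fem
      (n_outward _ _ epT Fep) (n_outward _ _ emT Fem).
  have Fsub e : F \in facets_of d e -> F \subset e by rewrite inE => /andP[].
  (* Two distinct elements exhaust a set of cardinality 2. *)
  have pairE : [set ep; em]%SET = [set e' in elements T | F \subset e']%SET.
    apply/eqP; rewrite eqEcard (interior_facet_shared epT Fep F_int).
    rewrite cards2 (introN eqP epm) andbT.
    apply/fintype.subsetP => e; rewrite !inE => /orP[] /eqP->.
      by rewrite epT Fsub.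
    by rewrite emT Fsub.
  have := balance ep F x epT Fep Fx; rewrite -pairE big_setU1 ?big_set1/=; last first.
    by rewrite inE; apply/eqP.
  by rewrite /normal_jump !dotBl n_opp !dotNr opprK addrACA addNr addr0.
- move=> F [FT F_bdy] e eT Fe x Fx.
  have /eqP/cards1P[e0 e0E] := boundary_facet_unshared eT Fe F_bdy.
  have : e \in [set e' in elements T | F \subset e']%SET.
    by rewrite inE eT; move: Fe; rewrite inE => /andP[->].
  rewrite e0E inE => /eqP ee0.
  have := balance e F x eT Fe Fx.
  by rewrite e0E big_set1 -ee0 dotBl => /eqP; rewrite subr_eq0 => /eqP.
Qed.
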